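(* There exists a universal constant $A_3>0$ such that for every $n\ge1$ and any two convex bodies $A,B\subset\mathbb{R}^n$, \[ \mathrm{Vol}(A+B)^{1/n}\le A_3\,\mathrm{Vol}(A-B)^{1/n}. \]
   Context: A convex body is a bounded convex set with non-empty interior. $A+B=\{a+b:a\in A,b\in B\}$ and $A-B=\{a-b:a\in A,b\in B\}$ denote Minkowski sum and difference. *)

(* Defs.v *)
From HB Require Import structures.
From mathcomp Require Import all_boot all_order all_algebra.
From mathcomp Require Import all_classical all_reals all_analysis.
Set Implicit Arguments. Unset Strict Implicit. Unset Printing Implicit Defensive.
Import Order.TTheory GRing.Theory Num.Theory.
Import numFieldNormedType.Exports.
Local Open Scope classical_set_scope.
Local Open Scope ring_scope.

Definition convexR (R : realType) (n : nat) (A : set 'rV[R]_n) : Prop :=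
  forall x y (t : R), A x -> A y -> 0 <= t -> t <= 1 ->
    A (t *: x + (1 - t) *: y).

Definition convex_body (R : realType) (n : nat) (A : set 'rV[R]_n) : Prop :=
  [/\ convexR A, bounded_set A & (A°) !=set0].

Definition mink_sum (R : realType) (n : nat) (A B : set 'rV[R]_n) : set 'rV[R]_n :=
  [set a + b | a in A & b in B].
Definition mink_diff (R : realType) (n : nat) (A B : set 'rV[R]_n) : set 'rV[R]_n :=
  [set a - b | a in A & b in B].

Definition box (R : realType) (n : nat) (a b : 'rV[R]_n) : set 'rV[R]_n :=
  [set x | forall i, a ord0 i <= x ord0 i <= b ord0 i].
Definition boxvol (R : realType) (n : nat) (a b : 'rV[R]_n) : R :=
  \prod_(i < n) (b ord0 i - a ord0 i).

Definition lebesgue_vol (R : realType) (n : nat) (A : set 'rV[R]_n) : \bar R :=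
  ereal_inf [set s : \bar R | exists a b : nat -> 'rV[R]_n,
    [/\ (forall k i, a k ord0 i <= b k ord0 i),
         A `<=` \bigcup_k box (a k) (b k) &
         s = (\sum_(k <oo) (boxvol (a k) (b k))%:E)%E]].

(* Main.v *)
Require Import Defs.
From HB Require Import structures.
From mathcomp Require Import all_boot all_order all_algebra.
From mathcomp Require Import all_classical all_reals all_analysis.
From mathcomp Require Import zify ring lra.
Import Order.TTheory GRing.Theory Num.Theory.
Import numFieldNormedType.Exports.
Local Open Scope classical_set_scope.
Local Open Scope ring_scope.
Set Implicit Arguments. Unset Strict Implicit. Unset Printing Implicit Defensive.

(** The bound is a Ruzsa triangle inequality |A + B| |B| <= |A - B| |B + B|,
    which holds because a point g = a + b of A + B and a point z of B determine
    and are determined by b + z in B + B and g - b - z in A - B; for convex B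
    one has |B + B| = 2^n |B|.  To avoid measure theory in R^n, volumes are
    replaced by numbers of points of a fine grid: |A + B| is bounded by covering
    with grid cubes, |A - B| is bounded from below by compactness, and the
    rounding errors are absorbed by the cubes that A and B contain.  Constants
    are not optimised: the scaling by 4 that leaves room for the rounding is
    why the result is 32 = 4 * 4 * 2. *)

(** * Counting integer points *)

Definition grid_point (R : realType) (n : nat) (e : R) (z : 'rV[int]_n) :
  'rV[R]_n := \row_i (e * (z ord0 i)%:~R).

Lemma leq_size_inj_in (T1 T2 : eqType) (s : seq T1) (t : seq T2) (f : T1 -> T2) :
  uniq s -> {in s &, injective f} -> (forall x, x \in s -> f x \in t) ->
  (size s <= size t)%N.
Proof.
move=> us fi st; rewrite -(size_map f); apply: uniq_leq_size.
  by rewrite map_inj_in_uniq.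
by move=> _ /mapP[x xs ->]; exact: st.
Qed.

(** Shifting by [M] puts each coordinate in [0..2M], so all candidates are values of a map from a
    finite function type; [P] is then decided classically. *)
Lemma lattice_enum (n : nat) (M : nat) (P : 'rV[int]_n -> Prop) :
  (forall z, P z -> forall i, `|z ord0 i| <= M%:Z) ->
  exists2 s : seq 'rV[int]_n, uniq s & forall z, (z \in s) <-> P z.
Proof.
move=> PM.
pose g (f : {ffun 'I_n -> 'I_(M + M).+1}) : 'rV[int]_n :=
  \row_i ((f i : nat)%:Z - M%:Z).
exists [seq z <- undup (codom g) | `[< P z >]].
  by rewrite filter_uniq// undup_uniq.
move=> z; rewrite mem_filter mem_undup; split => [/andP[/asboolP]//|Pz].
apply/andP; split; first exact/asboolP.
apply/codomP; exists [ffun i => inord `|(z ord0 i + M%:Z)%R|%N].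
apply/rowP => i; rewrite mxE ffunE.
have := PM _ Pz i; rewrite -[z 0 i]/(z ord0 i) ler_norml.
move: (z ord0 i : int) => w /andP[wl wu].
by rewrite inordK; lia.
Qed.

(** A point is determined by its coordinatewise quotients and remainders modulo [k], and there are
    [k ^ n] remainder vectors. *)
Lemma size_le_div (n : nat) (k : nat) (s t : seq 'rV[int]_n) :
  (0 < k)%N -> uniq s ->
  (forall z, z \in s -> (\row_i (z ord0 i %/ k%:Z)%Z) \in t) ->
  (size s <= k ^ n * size t)%N.
Proof.
case: k => // k _ us st.
pose f (z : 'rV[int]_n) : 'rV[int]_n * {ffun 'I_n -> 'I_k.+1} :=
  (\row_i (z ord0 i %/ k.+1%:Z)%Z,
   [ffun i => inord `|(z ord0 i %% k.+1%:Z)%Z|%N]).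
have -> : (k.+1 ^ n * size t)%N =
    size (allpairs pair t (enum {: {ffun 'I_n -> 'I_k.+1}})).
  by rewrite size_allpairs -cardT card_ffun !card_ord mulnC.
apply: (leq_size_inj_in (f := f)) => //.
  move=> z w _ _ [/rowP fd /ffunP fm]; apply/rowP => i.
  have {fd} := fd i; have {fm} := fm i; rewrite !mxE !ffunE => fm fd.
  rewrite (divz_eq (z ord0 i) k.+1) (divz_eq (w ord0 i) k.+1) fd.
  congr (_ + _).
  have bd (x : int) : (`|(x %% k.+1%:Z)%Z|%N < k.+1)%N.
    have := @ltz_pmod x k.+1 isT; have := @modz_ge0 x k.+1 isT; lia.
  move: fm => /(congr1 val) /=; rewrite !inordK ?bd//.
  have := @modz_ge0 (z ord0 i) k.+1 isT; have := @modz_ge0 (w ord0 i) k.+1 isT; lia.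
move=> z zs; apply/allpairsP; exists (f z) => /=; split => //.
  exact: st.
by rewrite mem_enum.
Qed.

(** Along coordinate [i] at most [m i + 1] grid values fit, and [e * (m i + 1)] is at most twice the
    side because the side is at least [e]; hence the factor [2 ^+ n]. *)
Lemma grid_card_box (R : realType) (n : nat) (a b p : 'rV[R]_n) (e : R)
    (s : seq 'rV[int]_n) : 0 < e -> (forall i, e <= b ord0 i - a ord0 i) ->
  uniq s -> (forall z, z \in s -> box a b (p + grid_point e z)) ->
  e ^+ n * (size s)%:R <= 2 ^+ n * boxvol a b.
Proof.
move=> e0 eab us sab.
pose lo i : int := Num.ceil ((a ord0 i - p ord0 i) / e).
pose m i := Num.trunc ((b ord0 i - a ord0 i) / e).
pose f (z : 'rV[int]_n) : {dffun forall i : 'I_n, 'I_(m i).+1} :=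
  [ffun i => inord `|(z ord0 i - lo i)%R|%N].
have key z i : z \in s -> lo i <= z ord0 i /\ (`|(z ord0 i - lo i)%R|%N <= m i)%N.
  move=> /sab /(_ i); rewrite !mxE => /andP[h1 h2].
  have h : lo i <= z ord0 i.
    by rewrite /lo ceil_le_int ler_pdivrMr// mulrC lerBlDl.
  split => //; rewrite /m.
  have zb : (z ord0 i - lo i)%:~R <= (b ord0 i - a ord0 i) / e.
    rewrite rmorphB/= ler_pdivlMr// mulrBl.
    have : (a ord0 i - p ord0 i) <= (lo i)%:~R * e.
      by rewrite -ler_pdivrMr// ceil_ge.
    lra.
  rewrite -ltnS -(ltr_nat R); apply: le_lt_trans (truncnS_gt _).
  by rewrite natr_absz ger0_norm// subr_ge0.
have finj : {in s &, injective f}.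
  move=> z w zs ws /ffunP fE; apply/rowP => i.
  have [lz mz] := key z i zs; have [lw mw] := key w i ws.
  have := fE i; rewrite !ffunE => /(congr1 val) /=.
  rewrite !inordK ?ltnS// -[z 0 i]/(z ord0 i) -[w 0 i]/(w ord0 i).
  move: (lo i) (z ord0 i : int) (w ord0 i : int) lz lw => {mz mw}; lia.
have : (size s <= \prod_i (m i).+1)%N.
  have -> : (\prod_i (m i).+1)%N = #|{: {dffun forall i : 'I_n, 'I_(m i).+1}}|.
    rewrite card_dep_ffun foldrE big_map big_enum /=.
    by apply: eq_bigr => i _; rewrite card_ord.
  rewrite -(size_map f) cardT; apply: uniq_leq_size.
    by rewrite map_inj_in_uniq.
  by move=> x _; rewrite mem_enum.
rewrite -(ler_nat R) => /(ler_wpM2l (exprn_ge0 n (ltW e0))) /le_trans; apply.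
rewrite natr_prod.
have pc (c : R) : c ^+ n = \prod_(i < n) c by rewrite prodr_const card_ord.
rewrite /boxvol !pc -!big_split /=; apply: ler_prod => i _.
rewrite mulr_ge0 ?ler0n ?(ltW e0)//=.
have hm : (m i)%:R <= (b ord0 i - a ord0 i) / e.
  by rewrite /m truncn_le// divr_ge0// ?(ltW e0)// (le_trans (ltW e0)).
move: hm; rewrite ler_pdivlMr// -natr1 => hm.
have := eab i; lra.
Qed.

(** * Bounds on [lebesgue_vol] by grid counts *)

Lemma boxvol_ge0 (R : realType) (n : nat) (a b : 'rV[R]_n) :
  (forall i, a ord0 i <= b ord0 i) -> 0 <= boxvol a b.
Proof. by move=> ab; apply: prodr_ge0 => i _; rewrite subr_ge0. Qed.

Lemma lebesgue_vol_ge0 (R : realType) (n : nat) (A : set 'rV[R]_n) :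
  (0 <= lebesgue_vol A)%E.
Proof.
apply: le_ereal_inf_tmp => _ [a [b [ab _ ->]]].
by apply: nneseries_ge0 => k _ _; rewrite lee_fin boxvol_ge0.
Qed.

Lemma lebesgue_vol_le_cubes (R : realType) (n : nat) (S : set 'rV[R]_n)
    (p : 'rV[R]_n) (h : R) (s : seq 'rV[int]_n) : (0 < n)%N -> 0 <= h ->
  (forall x, S x -> exists2 z, z \in s &
    box (p + grid_point h z) (p + grid_point h z + const_mx h) x) ->
  (lebesgue_vol S <= (h ^+ n * (size s)%:R)%:E)%E.
Proof.
move=> n0 h0 Ss.
(* The cover has to be an infinite sequence: past the end of [s] the cubes degenerate to points, of
   volume [0 ^+ n = 0] since [0 < n]. *)
pose w k : R := if (k < size s)%N then h else 0.
pose a k : 'rV[R]_n := p + grid_point h (nth 0 s k).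
pose b k : 'rV[R]_n := a k + const_mx (w k).
apply: ereal_inf_lbound; exists a, b; split.
- move=> k i; rewrite !mxE lerDl /w; by case: ifP.
- move=> x /Ss [z zs zx]; exists (index z s) => //.
  by rewrite /b /a /w index_mem zs nth_index.
have vE k : boxvol (a k) (b k) = w k ^+ n.
  rewrite /boxvol (eq_bigr (fun=> w k)); first by rewrite prodr_const card_ord.
  by move=> i _; rewrite !mxE; ring.
rewrite (nneseries_split 0%N (size s)); last first.
  by move=> k _; rewrite lee_fin vE exprn_ge0// /w; case: ifP.
rewrite eseries0 ?adde0; last first.
  by move=> k; rewrite add0n vE /w ltnNge => -> _ /=; rewrite expr0n gtn_eqF.
rewrite add0n big_mkord sumEFin; congr EFin.
rewrite (eq_bigr (fun=> h ^+ n)); last by move=> k _; rewrite vE /w ltn_ord.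
by rewrite sumr_const card_ord mulr_natr.
Qed.

(** The product is a polynomial in [t], hence continuous at 0. [t] is added twice because boxes get
    thickened on both sides. *)
Lemma prod_shift_le (R : realType) (n : nat) (c : 'I_n -> R) (eta : R) :
  0 < eta -> exists2 t : R, 0 < t & \prod_i (c i + t + t) <= \prod_i c i + eta.
Proof.
move=> eta0.
have : continuous (horner (\prod_i ((c i)%:P + 'X + 'X))) by exact: continuous_horner.
move=> /(_ 0) /cvgrPdist_le /(_ _ eta0) => /nbhs_ballP[d /= d0].
have d2 : 0 < d / 2 by rewrite divr_gt0.
move=> /(_ (d / 2)); rewrite /ball/= sub0r normrN gtr0_norm//.
move=> /(_ _) H; exists (d / 2) => //.
have {H} := H (ltac:(lra)).
rewrite !horner_prod ler_norml => /andP[H _].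
rewrite (eq_bigr (fun i => ((c i)%:P + 'X + 'X).[d / 2])); last first.
  by move=> i _; rewrite !hornerE.
rewrite [X in _ <= X + _](eq_bigr (fun i => ((c i)%:P + 'X + 'X).[0])); last first.
  by move=> i _; rewrite !hornerE.
lra.
Qed.

Lemma size_le_sum_count (T I : Type) (s : seq T) (r : seq I) (P : I -> pred T) :
  all (fun z => has (P^~ z) r) s -> (size s <= \sum_(k <- r) count (P k) s)%N.
Proof.
elim: s => [|z s IH] //= /andP[zr /IH sr].
rewrite big_split /= -addn1 addnC leq_add//.
elim: r zr {IH sr} => //= k r IH; rewrite big_cons.
by case: (P k z) => //= /IH; rewrite add0n.
Qed.

Lemma pos_lower_bound_seq (R : realType) (t : nat -> R) (r : seq nat) :
  (forall k, 0 < t k) -> exists2 e : R, 0 < e & forall k, k \in r -> e <= t k.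
Proof.
move=> t0; elim: r => [|j r [e e0 er]]; first by exists 1.
exists (Num.min e (t j)); first by rewrite lt_min e0 t0.
move=> k; rewrite in_cons => /orP[/eqP ->|/er]; first by rewrite ge_min lexx orbT.
by rewrite ge_min => ->.
Qed.

(* Thickening the boxes of a countable cover makes them open at small cost, so
   that finitely many suffice; a grid finer than the thickening then has at most
   [2^n vol / e^n] points in each box. *)
Lemma grid_card_le_vol (R : realType) (n : nat) (K D : set 'rV[R]_n) (v : R) :
  compact K -> K `<=` D -> (lebesgue_vol D < v%:E)%E ->
  exists2 e0 : R, 0 < e0 & forall (e : R) (p : 'rV[R]_n) (s : seq 'rV[int]_n),
    0 < e -> e <= e0 -> uniq s -> (forall z, z \in s -> K (p + grid_point e z)) ->
    e ^+ n * (size s)%:R <= 2 ^+ n * v.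
Proof.
move=> Kc KD /ereal_inf_lt[_ [a [b [ab Dab ->]]]].
set S := (X in (X < _)%E) => Sv.
have S0 : (0 <= S)%E.
  by apply: nneseries_ge0 => k _ _; rewrite lee_fin boxvol_ge0.
have Sfin : S \is a fin_num by rewrite ge0_fin_numE// (lt_trans Sv)// ltry.
pose eta := v - fine S.
have eta0 : 0 < eta by rewrite subr_gt0 -lte_fin fineK.
(* The extra volumes [eta / 2 ^ k.+1] sum to [eta], the gap between the total volume of the cover
   and [v]. *)
have /choice[t tP] (k : nat) : exists t : R, 0 < t /\
    boxvol (a k - const_mx t) (b k + const_mx t) <=
    boxvol (a k) (b k) + eta / (2 ^ k.+1)%:R.
  have ek : 0 < eta / (2 ^ k.+1)%:R by rewrite divr_gt0// ltr0n expn_gt0.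
  have [t t0 th] := @prod_shift_le R n (fun i => b k ord0 i - a k ord0 i) _ ek.
  exists t; split => //; apply: le_trans th.
  rewrite le_eqVlt; apply/orP; left; apply/eqP.
  by apply: eq_bigr => i _; rewrite !mxE; ring.
pose a' k := a k - const_mx (t k); pose b' k := b k + const_mx (t k).
have t0 k : 0 < t k by case: (tP k).
have ab' k i : t k <= b' k ord0 i - a' k ord0 i.
  by rewrite !mxE; have := ab k i; have := t0 k; lra.
have Kcov : finite_subset_cover [set: nat] (fun k => (box (a' k) (b' k))°) K.
  move: Kc; rewrite compact_cover; apply.
    by move=> k _; exact: open_interior.
  move=> x /KD /Dab [k _ xk]; exists k => //.
  apply/nbhs_ballP; exists (t k) => //= y [_ xy] i.
  have := xy ord0 i; rewrite /ball/= ltr_norml => /andP[h1 h2].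
  by rewrite !mxE; have := xk i => /andP[]; lra.
have {Kcov} [F _ KF] := Kcov.
pose N := (\max_(k <- finmap.enum_fset F) k).+1.
have KN x : K x -> exists2 k, (k < N)%N & box (a' k) (b' k) x.
  move=> /KF [k /= kF /interior_subset xk]; exists k => //.
  by rewrite ltnS (leq_bigmax_seq k).
(* Only [N] boxes remain, so their [t k] have a positive lower bound; a step below it is at most
   every thickened side, as [grid_card_box] requires. *)
have [e0 e00 e0t] := pos_lower_bound_seq (iota 0 N) t0.
exists e0 => // e p s eg0 ee0 us sK.
pose P k : pred 'rV[int]_n := fun z => `[< box (a' k) (b' k) (p + grid_point e z) >].
have sz : (size s <= \sum_(k <- iota 0 N) count (P k) s)%N.
  apply: size_le_sum_count; apply/allP => z /sK /KN [k kN kz].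
  by apply/hasP; exists k; [rewrite mem_iota|exact/asboolP].
move: sz; rewrite -(ler_nat R) => /(ler_wpM2l (exprn_ge0 n (ltW eg0))) /le_trans.
apply; rewrite natr_sum mulr_sumr.
apply: (@le_trans _ _ (\sum_(k <- iota 0 N) 2 ^+ n * boxvol (a' k) (b' k))).
  rewrite big_seq [leRHS]big_seq; apply: ler_sum => k kN.
  rewrite -size_filter; apply: (grid_card_box (p := p)) => //.
  - by move=> i; apply: le_trans (ab' k i); apply: le_trans (e0t _ kN).
  - exact: filter_uniq.
  - by move=> z; rewrite mem_filter => /andP[/asboolP].
rewrite -mulr_sumr ler_wpM2l ?exprn_ge0//.
apply: (@le_trans _ _ (\sum_(k <- iota 0 N)
    (boxvol (a k) (b k) + eta / (2 ^ k.+1)%:R))).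
  by apply: ler_sum => k _; case: (tP k).
have -> : v = fine S + eta by rewrite /eta addrC subrK.
rewrite -lee_fin -sumEFin EFinD fineK//.
apply: le_trans (epsilon_trick xpredT _ (ltW eta0)); last first.
  by move=> k; rewrite lee_fin boxvol_ge0.
have -> : iota 0 N = index_iota 0 N by rewrite /index_iota subn0.
under eq_bigr do rewrite EFinD.
apply: (nneseries_lim_ge N) => k _ _.
rewrite -EFinD lee_fin addr_ge0 ?boxvol_ge0//.
by rewrite divr_ge0 ?ler0n// ltW.
Qed.

(** * Bounded sets, inner cubes and rounding in convex sets *)

Lemma coord_le_norm (R : realType) (n : nat) (x : 'rV[R]_n) (i : 'I_n) :
  `|x ord0 i| <= `|x|.
Proof.
rewrite [leRHS]mx_normrE.
exact: (@le_bigmax _ _ _ 0 (fun ij : 'I_1 * 'I_n => `|x ij.1 ij.2|) (ord0, i)).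
Qed.

Lemma bounded_set_norm (R : realType) (n : nat) (A : set 'rV[R]_n) :
  bounded_set A -> exists M : R, forall x, A x -> `|x| <= M.
Proof. by move=> [M [_ AM]]; exists (M + 1); apply: AM; rewrite ltrDl. Qed.

Lemma interior_cube (R : realType) (n : nat) (A : set 'rV[R]_n) :
  A° !=set0 -> exists (a : 'rV[R]_n) (r : R), 0 < r /\
    forall y : 'rV[R]_n, (forall i, `|y ord0 i| <= r) -> A (a + y).
Proof.
move=> [a /nbhs_ballP[r /= r0 rA]]; exists a, (r / 2).
have r20 : 0 < r / 2 by rewrite divr_gt0.
split => // y yr; apply: rA; split => // i j; rewrite !ord1.
rewrite /ball /= !mxE opprD addrA subrr sub0r normrN.
by have := yr j; lra.
Qed.

(** For [be > 0] the point [be^-1 *: y] lies in the cube, so [al *: x + y] is a convex combination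
    of [x], [be^-1 *: y] and 0 with weights [al], [be], [1 - al - be]. Rounding errors [y] are
    absorbed this way, at the price of shrinking [x]. *)
Lemma convex_thicken (R : realType) (n : nat) (C : set 'rV[R]_n) (r al be : R)
    (x y : 'rV[R]_n) :
  convexR C -> 0 < r -> (forall z : 'rV[R]_n, (forall i, `|z ord0 i| <= r) -> C z) ->
  0 <= al -> 0 <= be -> al + be <= 1 -> C x ->
  (forall i, `|y ord0 i| <= be * r) -> C (al *: x + y).
Proof.
move=> Cc r0 rC al0 be0 abe1 Cx yr.
have C0 : C 0 by apply: rC => i; rewrite mxE normr0 ltW.
have [be_eq0|be_neq0] := eqVneq be 0.
  have -> : y = (1 - al) *: 0.
    apply/rowP => i; rewrite scaler0 mxE; apply/eqP.
    by rewrite -normr_eq0 eq_le normr_ge0 andbT -(mul0r r) -be_eq0 yr.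
  by apply: (Cc) => //; lra.
have bepos : 0 < be by rewrite lt_neqAle eq_sym be_neq0.
have Cy : C (be^-1 *: y).
  apply: rC => i; rewrite mxE normrM ger0_norm ?invr_ge0//.
  by rewrite ler_pdivrMl.
have lpos : 0 < al + be by lra.
have -> : al *: x + y = (al + be) *: ((al / (al + be)) *: x +
    (1 - al / (al + be)) *: (be^-1 *: y)) + (1 - (al + be)) *: 0.
  apply/rowP => i; rewrite !mxE; field.
  by rewrite be_neq0 gt_eqF.
apply: (Cc); [|exact: C0|exact: ltW|exact: abe1].
apply: (Cc) => //; first by rewrite divr_ge0// ltW.
by rewrite ler_pdivrMr//; lra.
Qed.

(** * The Ruzsa inequality on the grid *)

Lemma lattice_coord_le (R : realType) (e c : R) (z : int) :
  0 < e -> `|e * z%:~R| <= c -> `|z| <= (Num.trunc (c / e)).+1%:Z.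
Proof.
move=> e0 h; rewrite -(ler_int R) intr_norm ltW//.
apply: le_lt_trans (truncnS_gt _).
by rewrite ler_pdivlMr// mulrC -[in leLHS](gtr0_norm e0) -normrM.
Qed.

Lemma floor_dist (R : realType) (e x : R) : 0 < e ->
  e * (Num.floor (x / e))%:~R <= x <= e * (Num.floor (x / e))%:~R + e.
Proof.
move=> e0; have := floor_itv (x / e) => /andP[h1 h2].
move: h1 h2; rewrite intrD ler_pdivlMr// ltr_pdivrMr// => h1 h2.
by apply/andP; split; lra.
Qed.

(* [G] stands for (A + B)/4 and [Q] for (A - B)/2; with [bh g] a rounding of the
   B-part of [g], the map [(g, z) |-> (bh g + z, g - bh g - z)] is injective. *)
Lemma grid_ruzsa (R : realType) (n : nat) (A B : set 'rV[R]_n) (r M e : R) :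
  convexR A -> convexR B -> 0 < r ->
  (forall z : 'rV[R]_n, (forall i, `|z ord0 i| <= r) -> A z) ->
  (forall z : 'rV[R]_n, (forall i, `|z ord0 i| <= r) -> B z) ->
  (forall x, A x -> `|x| <= M) -> (forall x, B x -> `|x| <= M) ->
  0 < e -> e <= r / 8 ->
  exists G Q : seq 'rV[int]_n, [/\ uniq Q,
    forall a b, A a -> B b ->
      (\row_i Num.floor ((a ord0 i + b ord0 i) / (4 * e))) \in G,
    forall q, q \in Q ->
      exists a b, [/\ A a, B b & grid_point e q = 2^-1 *: (a - b)] &
    (size G <= 4 ^ n * size Q)%N].
Proof.
move=> Ac Bc r0 rA rB AM BM e0 er.
(* Grid points within [e] of (A + B)/4: rounding a + b down with step [4 * e] produces such a
   point. *)
pose isG (z : 'rV[int]_n) := exists a b, [/\ A a, B b &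
  forall i, `|e * (z ord0 i)%:~R - (a ord0 i + b ord0 i) / 4| <= e].
have [|G uG memG] := @lattice_enum n (Num.trunc ((e + M) / e)).+1 isG.
  move=> z [a [b [/AM aM /BM bM zab]]] i; apply: (lattice_coord_le e0).
  have := zab i; have := le_trans (coord_le_norm a i) aM.
  have := le_trans (coord_le_norm b i) bM.
  by rewrite !ler_norml => /andP[? ?] /andP[? ?] /andP[? ?]; apply/andP; split; lra.
(* [Z] lists the grid points of B/2, over which the second argument of the Ruzsa map ranges. *)
have [|Z uZ memZ] :=
    @lattice_enum n (Num.trunc (M / e)).+1 (fun z => B (2 *: grid_point e z)).
  move=> z /BM zM i; apply: (lattice_coord_le e0).
  have := le_trans (coord_le_norm _ i) zM; rewrite !mxE.
  by rewrite !ler_norml => /andP[? ?]; apply/andP; split; lra.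
have Z0 : (0 < size Z)%N.
  suff : 0 \in Z by case: (Z).
  by apply/memZ/rB => i; rewrite !mxE mulr0 mulr0 normr0 ltW.
(* Choice makes [bh] a function of [g] alone, on which injectivity rests; 0 is a default outside
   [isG]. *)
have /choice[bh bhP] (g : 'rV[int]_n) : exists c : 'rV[int]_n, isG g ->
    exists a b, [/\ A a, B b,
      forall i, `|e * (g ord0 i)%:~R - (a ord0 i + b ord0 i) / 4| <= e &
      forall i, `|e * (c ord0 i)%:~R - b ord0 i / 4| <= e].
  have [[a [b [Aa Bb gab]]]|] := pselect (isG g); last by exists 0.
  exists (\row_i Num.floor (b ord0 i / 4 / e)) => _; exists a, b; split => // i.
  have /andP[? ?] := floor_dist (b ord0 i / 4) e0.
  by rewrite mxE ler_norml; apply/andP; split; lra.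
pose P := undup [seq bh g + z | g <- G, z <- Z].
pose Q := undup [seq g - bh g - z | g <- G, z <- Z].
have PB p : p \in P -> B (grid_point e p).
  rewrite mem_undup => /allpairsP[[g z] /= [/memG/bhP[a [b [Aa Bb _ bb]]] /memZ zB ->]].
  (* Before rounding, [bh g + z] is b/4 + z, which equals 3/4 of [w]; the remaining weight 1/4
     absorbs an error of at most [e]. *)
  pose w := (1 / 3) *: b + (1 - 1 / 3) *: (2 *: grid_point e z).
  have Bw : B w by apply: Bc => //; lra.
  pose y : 'rV[R]_n := grid_point e (bh g) - 4^-1 *: b.
  have -> : grid_point e (bh g + z) = (3 / 4) *: w + y.
    by apply/rowP => i; rewrite !mxE intrD; field.
  apply: (convex_thicken (be := 4^-1) Bc r0 rB) => //; try lra.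
  move=> i; rewrite !mxE; have := bb i.
  by rewrite !ler_norml => /andP[? ?]; apply/andP; split; lra.
(* Dividing by 4 rather than 2 sends B to B/4, well inside B/2: twice the rounded quotient is half
   the point plus an error of at most [2 * e], for which the weight 1/2 is free. *)
have szP : (size P <= 4 ^ n * size Z)%N.
  apply: size_le_div => //; first exact: undup_uniq.
  move=> p /PB pB; apply/memZ.
  pose y : 'rV[R]_n := 2 *: grid_point e (\row_i (p ord0 i %/ 4%:Z)%Z)
    - 2^-1 *: grid_point e p.
  have -> : 2 *: grid_point e (\row_i (p ord0 i %/ 4%:Z)%Z) =
      2^-1 *: grid_point e p + y by rewrite addrC subrK.
  apply: (convex_thicken (be := 2^-1) Bc r0 rB) => //; try lra.
  move=> i; rewrite !mxE.
  have : 0 <= (p ord0 i %% 4)%Z by exact: modz_ge0.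
  have : (p ord0 i %% 4)%Z <= 4 by rewrite ltW// ltz_pmod.
  have : (p ord0 i)%:~R = (p ord0 i %/ 4)%Z%:~R * 4 + (p ord0 i %% 4)%Z%:~R :> R.
    by rewrite {1}(divz_eq (p ord0 i) 4) intrD intrM.
  rewrite -!(ler_int R).
  set u := (_ %% _)%Z%:~R; set w := (_ %/ _)%Z%:~R => -> u4 u0.
  have eu0 : 0 <= e * u by rewrite mulr_ge0// ltW.
  have eu4 : e * u <= e * 4 by rewrite ler_wpM2l// ltW.
  by rewrite ler_norml; apply/andP; split; lra.
exists G, Q; split.
- exact: undup_uniq.
- move=> a b Aa Bb; apply/memG; exists a, b; split => // i; rewrite mxE.
  have e4 : 0 < 4 * e by rewrite mulr_gt0.
  have /andP[? ?] := floor_dist (a ord0 i + b ord0 i) e4.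
  by rewrite ler_norml; apply/andP; split; lra.
- move=> q; rewrite mem_undup.
  move=> /allpairsP[[g z] /= [/memG/bhP[a [b [Aa Bb gab bb]]] /memZ zB ->]].
  (* [g - bh g] approximates a/4. Two rounding errors, doubled, give at most [4 * e], which fits in
     [r / 2] exactly because [e <= r / 8]. *)
  pose y : 'rV[R]_n :=
    2 *: (grid_point e g - grid_point e (bh g) - 4^-1 *: a).
  exists (2^-1 *: a + y), (2 *: grid_point e z); split => //.
    apply: (convex_thicken (be := 2^-1) Ac r0 rA) => //; try lra.
    move=> i; rewrite !mxE; have := gab i; have := bb i.
    by rewrite !ler_norml => /andP[? ?] /andP[? ?]; apply/andP; split; lra.
  by apply/rowP => i; rewrite !mxE !rmorphB /=; field.
(* Since [size P] is at most [4 ^ n * size Z], the positive factor [size Z] cancels. *)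
suff : (size G * size Z <= size P * size Q)%N.
  move=> /leq_trans /(_ (leq_mul szP (leqnn _))).
  by rewrite mulnAC leq_pmul2r.
rewrite -(size_allpairs pair G Z) -(size_allpairs pair P Q).
apply: (leq_size_inj_in (f := fun gz => (bh gz.1 + gz.2, gz.1 - bh gz.1 - gz.2))).
- by apply: allpairs_uniq => // -[? ?] [? ?].
- move=> [g z] [g' z'] _ _ /= [h1 h2].
  (* The two components add up to [g]; this determines [bh g], and then [z]. *)
  have sumE (u v w : 'rV[int]_n) : (v + w) + (u - v - w) = u.
    by rewrite -(addrA u) -opprD [LHS]addrC subrK.
  have gE : g = g' by rewrite -(sumE g (bh g) z) h1 h2 sumE.
  by move: h1; rewrite gE => /addrI ->.
- move=> _ /allpairsP[[g z] /= [gG zZ ->]] /=.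
  apply: allpairs_f; rewrite mem_undup.
    by apply: (allpairs_f (fun g z => bh g + z)).
  by apply: (allpairs_f (fun g z => g - bh g - z)).
Qed.

(** * From grid counts back to volumes *)

Lemma closure_coord (R : realType) (n : nat) (S : set 'rV[R]_n) (x : 'rV[R]_n)
    (d : R) : 0 < d -> closure S x ->
  exists2 y, S y & forall i, `|x ord0 i - y ord0 i| <= d.
Proof.
move=> d0 /(_ _ (nbhsx_ballx x d d0)) [y [Sy [_ xy]]]; exists y => // i.
exact: ltW (xy ord0 i).
Qed.

Lemma convexR_translate (R : realType) (n : nat) (A : set 'rV[R]_n) (a : 'rV[R]_n) :
  convexR A -> convexR [set x | A (a + x)].
Proof.
move=> Ac x y t Ax Ay t0 t1 /=.
have -> : a + (t *: x + (1 - t) *: y) = t *: (a + x) + (1 - t) *: (a + y).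
  by apply/rowP => i; rewrite !mxE; ring.
exact: Ac.
Qed.

Lemma bounded_set_translate (R : realType) (n : nat) (A : set 'rV[R]_n)
    (a : 'rV[R]_n) : bounded_set A ->
  exists M : R, forall x, A (a + x) -> `|x| <= M.
Proof.
move=> /bounded_set_norm [M AM]; exists (M + `|a|) => x /AM axM.
have -> : x = a + x - a by rewrite addrC addKr.
by rewrite (le_trans (ler_normB _ _))// lerD2r.
Qed.

Lemma lebesgue_vol_bounded_fin (R : realType) (n : nat) (D : set 'rV[R]_n) (M : R) :
  (0 < n)%N -> (forall x, D x -> `|x| <= M) -> lebesgue_vol D \is a fin_num.
Proof.
move=> n0 DM; rewrite ge0_fin_numE ?lebesgue_vol_ge0//.
apply: le_lt_trans (ltry _).
(* A single cube of side 2|M| centred at 0; the absolute value covers a negative [M], possible when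
   [D] is empty. *)
apply: (@lebesgue_vol_le_cubes _ _ D (const_mx (- `|M|)) (2 * `|M|) [:: 0]) => //.
move=> x /DM xM; exists 0; first exact: mem_head.
move=> i; rewrite !mxE mulr0.
have := le_trans (le_trans (coord_le_norm x i) xM) (ler_norm M).
by rewrite ler_norml => /andP[? ?]; apply/andP; split; lra.
Qed.

(** Cubes of side [4 * e] cover A + B, [grid_ruzsa] compares the counts, and [grid_card_le_vol]
    bounds the count for the difference; these cost [4 ^+ n], [4 ^+ n] and [2 ^+ n]. Both bodies are
    first translated to contain a cube about 0, and the translations reappear as offsets of the
    grids. *)
Lemma lebesgue_vol_mink_sum_le (R : realType) (n : nat) (A B : set 'rV[R]_n) (v : R) :
  (0 < n)%N -> convex_body A -> convex_body B ->
  (lebesgue_vol (mink_diff A B) < v%:E)%E ->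
  (lebesgue_vol (mink_sum A B) <= (32 ^+ n * v)%:E)%E.
Proof.
move=> n0 [Ac Ab /interior_cube[a0 [ra [ra0 raA]]]]
  [Bc Bb /interior_cube[b0 [rb [rb0 rbB]]]] Dv.
pose A1 : set 'rV[R]_n := [set x | A (a0 + x)]; pose B1 : set 'rV[R]_n := [set x | B (b0 + x)].
have A1c : convexR A1 by exact: convexR_translate.
have B1c : convexR B1 by exact: convexR_translate.
pose r := Num.min ra rb.
have r0 : 0 < r by rewrite lt_min ra0 rb0.
have rA1 (z : 'rV[R]_n) : (forall i, `|z ord0 i| <= r) -> A1 z.
  by move=> zr; apply: raA => i; apply: le_trans (zr i) _; rewrite ge_min lexx.
have rB1 (z : 'rV[R]_n) : (forall i, `|z ord0 i| <= r) -> B1 z.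
  by move=> zr; apply: rbB => i; apply: le_trans (zr i) _; rewrite ge_min lexx orbT.
have [MA A1M] := bounded_set_translate a0 Ab.
have [MB B1M] := bounded_set_translate b0 Bb.
pose M := Num.max MA MB.
have {}A1M x : A1 x -> `|x| <= M by move/A1M => h; rewrite le_max h.
have {}B1M x : B1 x -> `|x| <= M by move/B1M => h; rewrite le_max h orbT.
have B10 : B1 0 by apply: rB1 => i; rewrite mxE normr0 ltW.
(* A translate of (A1 - B1)/2: halving leaves room for its closure, taken to get a compact set, to
   stay inside A - B. *)
pose H : set 'rV[R]_n := [set x | exists a b, [/\ A1 a, B1 b &
  x = (a0 - b0) + 2^-1 *: (a - b)]].
have HD : closure H `<=` mink_diff A B.
  move=> x /(@closure_coord _ _ _ _ (2^-1 * r)) [|_ [a [b [Aa Bb1 ->]]] xH].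
    by rewrite mulr_gt0// invr_gt0.
  (* The closure error goes entirely to the A side, absorbed by the free weight 1/2; the B side is
     only shrunk towards 0. *)
  pose y := x - ((a0 - b0) + 2^-1 *: (a - b)).
  exists (a0 + (2^-1 *: a + y)).
    apply: (convex_thicken (be := 2^-1) A1c r0 rA1) => //; try lra.
    by move=> i; have := xH i; rewrite !mxE.
  exists (b0 + (2^-1 *: b + (1 - 2^-1) *: 0)).
    by apply: B1c => //; lra.
  by apply/rowP => i; rewrite !mxE; field.
have Hc : compact (closure H).
  apply: bounded_closed_compact; last exact: closed_closure.
  exists (`|a0| + `|b0| + M + M); split => [|L hL x /HD [a Aa [b Bb1 <-]]].
    exact: num_real.
  have hA : `|a - a0| <= M by apply: A1M; rewrite /A1/= addrC subrK.
  have hB : `|b - b0| <= M by apply: B1M; rewrite /B1/= addrC subrK.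
  have ha : `|a| <= M + `|a0|.
    by rewrite -[a in leLHS](subrK a0) (le_trans (ler_normD _ _))// lerD2r.
  have hb : `|b| <= M + `|b0|.
    by rewrite -[b in leLHS](subrK b0) (le_trans (ler_normD _ _))// lerD2r.
  apply: le_trans (le_trans (ler_normB a b) (lerD ha hb)) _.
  rewrite ltW//; apply: le_lt_trans hL.
  by rewrite le_eqVlt; apply/orP; left; apply/eqP; ring.
have [e0 e00 cardQ] := grid_card_le_vol Hc HD Dv.
pose e := Num.min e0 (r / 8).
have epos : 0 < e by rewrite lt_min e00 divr_gt0.
have ee0 : e <= e0 by rewrite ge_min lexx.
have er : e <= r / 8 by rewrite ge_min lexx orbT.
have [G [Q [uQ GP QP GQ]]] :=
  grid_ruzsa A1c B1c r0 rA1 rB1 A1M B1M epos er.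
have e4 : 0 < 4 * e by rewrite mulr_gt0.
apply: (@le_trans _ _ ((4 * e) ^+ n * (size G)%:R)%:E).
  apply: (@lebesgue_vol_le_cubes _ _ _ (a0 + b0)) => //; first exact: ltW.
  move=> _ [a Aa [b Bb1 <-]].
  have Aa1 : A1 (a - a0) by rewrite /A1/= addrC subrK.
  have Bb11 : B1 (b - b0) by rewrite /B1/= addrC subrK.
  eexists; first exact: (GP _ _ Aa1 Bb11).
  move=> i; have := floor_dist ((a - a0) ord0 i + (b - b0) ord0 i) e4.
  rewrite !mxE => /andP[? ?]; apply/andP; split; lra.
rewrite lee_fin.
have {}cardQ : e ^+ n * (size Q)%:R <= 2 ^+ n * v.
  apply: (cardQ e (a0 - b0)) => // q /QP [a [b [Aa Bb1 ->]]].
  by apply: subset_closure; exists a, b.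
have -> : (32 : R) = 4 * 4 * 2 by ring.
rewrite !exprMn -!mulrA ler_pM2l ?exprn_gt0//.
apply: (@le_trans _ _ (e ^+ n * (4 ^+ n * (size Q)%:R))).
  by rewrite ler_pM2l ?exprn_gt0// -natrX -natrM ler_nat.
by rewrite mulrCA ler_pM2l ?exprn_gt0.
Qed.

Theorem mainTheorem4 (R : realType) :
  exists A3 : R, 0 < A3 /\
    forall (n : nat), (1 <= n)%N ->
    forall A B : set 'rV[R]_n, convex_body A -> convex_body B ->
      (fine (lebesgue_vol (mink_sum A B))) `^ (n%:R^-1)
        <= A3 * (fine (lebesgue_vol (mink_diff A B))) `^ (n%:R^-1).
Proof.
exists 32; split => // n n0 A B bA bB.
have Dfin : lebesgue_vol (mink_diff A B) \is a fin_num.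
  have [_ /bounded_set_norm[MA AM] _] := bA.
  have [_ /bounded_set_norm[MB BM] _] := bB.
  apply: (@lebesgue_vol_bounded_fin _ _ _ (MA + MB)) => // _ [a Aa [b Bb <-]].
  by rewrite (le_trans (ler_normB _ _))// lerD// ?AM ?BM.
set D := fine (lebesgue_vol (mink_diff A B)).
have D0 : 0 <= D by exact/fine_ge0/lebesgue_vol_ge0.
have p32 : 0 < 32 ^+ n :> R by rewrite exprn_gt0.
have SD : fine (lebesgue_vol (mink_sum A B)) <= 32 ^+ n * D.
  apply/ler_addgt0Pr => d d0.
  (* The volume lemma asks for a strict upper bound, so [D] is enlarged by an amount that costs only
     [d] after multiplication by [32 ^+ n]. *)
  have hv : (lebesgue_vol (mink_diff A B) < (D + d / 32 ^+ n)%:E)%E.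
    by rewrite -(fineK Dfin) lte_fin ltrDl divr_gt0.
  have := lebesgue_vol_mink_sum_le n0 bA bB hv.
  rewrite mulrDr [_ * (d / _)]mulrC divfK ?gt_eqF// => h.
  have Sfin : lebesgue_vol (mink_sum A B) \is a fin_num.
    by rewrite ge0_fin_numE ?lebesgue_vol_ge0// (le_lt_trans h)// ltry.
  by rewrite -lee_fin fineK.
have n_neq0 : n%:R != 0 :> R by rewrite pnatr_eq0 -lt0n.
(* With 32 written as an [n]-th root, the claim is monotonicity of the root applied to [SD]. *)
have -> : (32 : R) = (32 ^+ n) `^ n%:R^-1.
  by rewrite -powR_mulrn// -powRrM divff// powRr1.
rewrite -powRM ?(ltW p32)//; apply: ge0_ler_powR => //.
- by rewrite nnegrE fine_ge0// lebesgue_vol_ge0.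
- by rewrite nnegrE mulr_ge0// ltW.
Qed.
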